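(* Let $\tau\ge 1$ and let $x[\tau],u[\tau],x[\tau+1]$ be real vectors of the appropriate dimensions satisfying the dynamics $x[\tau+1]=\tilde A x[\tau]+\tilde B u[\tau]$ and the transition constraint $\tilde A_{eq}x[\tau]=0$. Suppose $x[\tau+1]\in \mathrm{null}(\Psi_x[\tau+1])$ for some given real matrix $\Psi_x[\tau+1]$. Let $$\Gamma_A=\Psi_x[\tau+1]\tilde A,\qquad \Gamma_B=\Psi_x[\tau+1]\tilde B,$$ and let $$H_x=\operatorname*{argmin}_{M}\ \lVert \Gamma_B M+\Gamma_A\rVert,\qquad H_\lambda=\mathrm{basis}(\mathrm{null}(\Gamma_B)).$$ Then the set of admissible inputs at time $\tau$ is $$\mathcal A_u[\tau]=\{\hat u:\ \hat u=H_x x[\tau]+H_\lambda\lambda\ \text{ for some vector }\lambda\}.$$ Also, $x[\tau]\in\mathrm{null}(\Psi_x[\tau])$, where $$\Psi_x[\tau]=\mathrm{normalize}\left(\begin{bmatrix}\Gamma_B H_x+\Gamma_A\\ \tilde A_{eq}\end{bmatrix}\right).$$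
   Context: Fix real matrices $A\in\mathbb R^{n\times n}$, $B\in\mathbb R^{n\times m}$, $C\in\mathbb R^{p\times n}$ (the state, input and output matrices of a linear system). The system-response components $\Phi_{xx}[\tau]\in\mathbb R^{n\times n}$, $\Phi_{xy}[\tau]\in\mathbb R^{n\times p}$, $\Phi_{ux}[\tau]\in\mathbb R^{m\times n}$, $\Phi_{uy}[\tau]\in\mathbb R^{m\times p}$ are vectorized: for a matrix $M$, $\overrightarrow{M}$ is the column vector stacking the columns of $M$, and $$x[\tau]=\begin{bmatrix}\overrightarrow{\Phi_{xx}[\tau]}\\ \overrightarrow{\Phi_{xy}[\tau]}\\ \overrightarrow{\Phi_{ux}[\tau]}\end{bmatrix},\qquad u[\tau]=\overrightarrow{\Phi_{uy}[\tau]}.$$ The matrices $\tilde A,\tilde B,\tilde A_{eq}$ are those for which $x[\tau+1]=\tilde A x[\tau]+\tilde B u[\tau]$ is the vectorized form of $$\Phi_{xx}[\tau+1]=\Phi_{xx}[\tau]A+\Phi_{xy}[\tau]C,\quad \Phi_{xy}[\tau+1]=A\Phi_{xy}[\tau]+B\Phi_{uy}[\tau],\quad \Phi_{ux}[\tau+1]=\Phi_{ux}[\tau]A+\Phi_{uy}[\tau]C,$$ and $\tilde A_{eq}x[\tau]=0$ is the vectorized form of $A\Phi_{xx}[\tau]+B\Phi_{ux}[\tau]=\Phi_{xx}[\tau]A+\Phi_{xy}[\tau]C$. Explicitly, with $\otimes$ the Kronecker product, $$\tilde A=\begin{bmatrix}A^\top\otimes I_n & C^\top\otimes I_n & 0\\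 0& I_p\otimes A&0\\ 0&0&A^\top\otimes I_m\end{bmatrix},\quad \tilde B=\begin{bmatrix}0\\ I_p\otimes B\\ C^\top\otimes I_m\end{bmatrix},\quad \tilde A_{eq}=\begin{bmatrix}I_n\otimes A-A^\top\otimes I_n & -C^\top\otimes I_n & I_n\otimes B\end{bmatrix}.$$ The set of admissible inputs at time $\tau\geq 1$ (given the state $x[\tau]$ and the matrix $\Psi_x[\tau+1]$; no further system-level constraints are imposed) is $\mathcal A_u[\tau]=\{\hat u:\ \tilde A x[\tau]+\tilde B\hat u\in\mathrm{null}(\Psi_x[\tau+1])\}$. Notation: $\mathrm{null}(\Psi)=\{v:\Psi v=0\}$; $\mathrm{basis}(\mathcal S)$ denotes a matrix whose columns form a basis of the linear subspace $\mathcal S$ (it has no columns if $\mathcal S=\{0\}$); $\mathrm{normalize}(M)$ is the matrix whose rows are the non-zero rows of $M$, each scaled to unit norm (if $M$ has no non-zero row, this is the matrix with no rows, whose null space is the whole space). $\lVert\cdot\rVert$ is the Frobenius norm (least-squares regression), and $H_x=\operatorname{argmin}_M(\cdot)$ means that $H_x$ is a minimizer over all real matrices $M$ of compatible size. *)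

(* Defs.v *)
From HB Require Import structures.
From mathcomp Require Import all_boot all_order all_algebra.
From mathcomp Require Import mxtens.
From mathcomp Require Import classical_sets reals.

Set Implicit Arguments.
Unset Strict Implicit.
Unset Printing Implicit Defensive.

Import GRing.Theory Num.Theory.
Local Open Scope ring_scope.
Local Open Scope classical_set_scope.

Section Matrices.
Variable R : realType.

(* Column stacking: entry (i, j) of M goes to position j * m + i, the index
   convention of the Kronecker product [*t]. *)
Definition vec m n (M : 'M[R]_(m, n)) : 'cV[R]_(n * m) :=
  \col_k M (mxtens_unindex k).2 (mxtens_unindex k).1.

Definition frob m n (M : 'M[R]_(m, n)) : R :=
  Num.sqrt (\sum_i \sum_j M i j ^+ 2).

Definition is_argmin (T : Type) (f : T -> R) (x : T) : Prop :=
  forall y, f x <= f y.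

Definition mxnull m n (Psi : 'M[R]_(m, n)) : {vspace 'cV[R]_n} :=
  lker (linfun (mulmx Psi)).

(* k = 0 is allowed, and forced when S is the zero subspace. *)
Definition is_basis_mx n k (H : 'M[R]_(n, k)) (S : {vspace 'cV[R]_n}) : bool :=
  basis_of S [seq col j H | j <- enum 'I_k].

Definition nonzero_rows m n (M : 'M[R]_(m, n)) : {set 'I_m} :=
  [set i | row i M != 0]%SET.

(* [enum_val] is increasing here, so the remaining rows keep their order. *)
Definition normalize_rows m n (M : 'M[R]_(m, n)) :
    'M[R]_(#|nonzero_rows M|, n) :=
  \matrix_(i < #|nonzero_rows M|)
     ((frob (row (enum_val i) M))^-1 *: row (enum_val i) M).

End Matrices.

Notation state_dim n m p := (n * n + p * n + n * m)%N.
Notation input_dim m p := (p * m)%N.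

Section System.
Variables (R : realType) (n m p : nat).
Variables (A : 'M[R]_n) (B : 'M[R]_(n, m)) (C : 'M[R]_(p, n)).

Definition Atilde : 'M[R]_(state_dim n m p) :=
  block_mx
    (block_mx (A^T *t 1%:M : 'M_(n * n)) (C^T *t 1%:M : 'M_(n * n, p * n))
              0                          (1%:M *t A : 'M_(p * n)))
    0 0 (A^T *t 1%:M : 'M_(n * m)).

Definition Btilde : 'M[R]_(state_dim n m p, input_dim m p) :=
  col_mx (col_mx (0 : 'M_(n * n, p * m)) (1%:M *t B : 'M_(p * n, p * m)))
         (C^T *t 1%:M : 'M_(n * m, p * m)).

Definition Aeqtilde : 'M[R]_(n * n, state_dim n m p) :=
  row_mx (row_mx (1%:M *t A - A^T *t 1%:M : 'M_(n * n))
                 (- (C^T *t 1%:M) : 'M_(n * n, p * n)))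
         (1%:M *t B : 'M_(n * n, n * m)).

Definition admissible_inputs q (Psi : 'M[R]_(q, state_dim n m p))
    (x : 'cV[R]_(state_dim n m p)) : set 'cV[R]_(input_dim m p) :=
  [set uh | Atilde *m x + Btilde *m uh \in mxnull Psi].

End System.

Section Facts.
Variable R : realType.

Lemma mxnullP m n (Psi : 'M[R]_(m, n)) (v : 'cV[R]_n) :
  reflect (Psi *m v = 0) (v \in mxnull Psi).
Proof. by rewrite memv_ker lfunE; apply: eqP. Qed.

Lemma vec_mul a b c d (M : 'M[R]_(a, b)) (X : 'M[R]_(b, c)) (N : 'M[R]_(c, d)) :
  vec (M *m X *m N) = (N^T *t M) *m vec X.
Proof.
apply/colP => k; case: (mxtens_indexP k) => j i.
transitivity (\sum_l \sum_h M i h * X h l * N l j).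
  rewrite mxE mxtens_indexK /= mxE; apply: eq_bigr => l _.
  by rewrite mxE mulr_suml.
rewrite mxE (reindex (@mxtens_index c b)) /=; last first.
  by exists (@mxtens_unindex c b) => ? _;
    rewrite (mxtens_indexK, mxtens_unindexK).
rewrite pair_bigA; apply: eq_bigr => -[l h] _ /=.
by rewrite tensmxE !mxE mxtens_indexK /= mulrC mulrA.
Qed.

Lemma vecD a b (M N : 'M[R]_(a, b)) : vec (M + N) = vec M + vec N.
Proof. by apply/colP => k; rewrite !mxE. Qed.

Lemma vecN a b (M : 'M[R]_(a, b)) : vec (- M) = - vec M.
Proof. by apply/colP => k; rewrite !mxE. Qed.

Lemma vec_inj a b : injective (@vec R a b).
Proof.
move=> M N /colP e; apply/matrixP => i j.
by have := e (mxtens_index (j, i)); rewrite !mxE mxtens_indexK.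
Qed.

Lemma vec_mull a b c (M : 'M[R]_(a, b)) (X : 'M[R]_(b, c)) :
  vec (M *m X) = (1%:M *t M) *m vec X.
Proof. by rewrite -[1%:M]trmx1 -vec_mul mulmx1. Qed.

Lemma vec_mulr b c d (X : 'M[R]_(b, c)) (N : 'M[R]_(c, d)) :
  vec (X *m N) = (N^T *t 1%:M) *m vec X.
Proof. by rewrite -vec_mul mul1mx. Qed.

Variables (n m p : nat).
Variables (A : 'M[R]_n) (B : 'M[R]_(n, m)) (C : 'M[R]_(p, n)).

Definition state_vec (Pxx : 'M[R]_n) (Pxy : 'M[R]_(n, p)) (Pux : 'M[R]_(m, n)) :
    'cV[R]_(state_dim n m p) :=
  col_mx (col_mx (vec Pxx) (vec Pxy)) (vec Pux).

(* The explicit matrices are the vectorized forms of the system equations. *)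
Lemma dynamics_vecE Pxx Pxy Pux Puy Pxx' Pxy' Pux' :
  state_vec Pxx' Pxy' Pux' =
    Atilde m A C *m state_vec Pxx Pxy Pux + Btilde B C *m vec Puy <->
  [/\ Pxx' = Pxx *m A + Pxy *m C,
      Pxy' = A *m Pxy + B *m Puy &
      Pux' = Pux *m A + Puy *m C].
Proof.
have -> : Atilde m A C *m state_vec Pxx Pxy Pux + Btilde B C *m vec Puy =
  state_vec (Pxx *m A + Pxy *m C) (A *m Pxy + B *m Puy) (Pux *m A + Puy *m C).
  rewrite /Atilde /Btilde /state_vec !mul_block_col !mul_col_mx !mul0mx.
  by rewrite addr0 add0r !add_col_mx !addr0 !add0r !vecD !(vec_mull A) !(vec_mull B) !(vec_mulr _ A) !(vec_mulr _ C).
split=> [/eq_col_mx[/eq_col_mx[/vec_inj-> /vec_inj->] /vec_inj->] //|].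
by case=> -> -> ->.
Qed.

Lemma transition_vecE Pxx Pxy Pux :
  Aeqtilde A B C *m state_vec Pxx Pxy Pux = 0 <->
  A *m Pxx + B *m Pux = Pxx *m A + Pxy *m C.
Proof.
have -> : Aeqtilde A B C *m state_vec Pxx Pxy Pux =
    vec (A *m Pxx + B *m Pux) - vec (Pxx *m A + Pxy *m C).
  rewrite /Aeqtilde /state_vec !mul_row_col mulmxBl mulNmx.
  rewrite !vecD -!vec_mull -!vec_mulr.
  by rewrite opprD addrACA [X in _ = _ + X]addrC addrA.
by split=> [/subr0_eq/vec_inj //|->]; rewrite subrr.
Qed.

End Facts.

(* Main.v *)
Require Import Defs.
From mathcomp Require Import all_boot all_order all_algebra.
From mathcomp Require Import classical_sets reals ring lra.

(** At time tau the dynamics turn the constraint on the next state into the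
    linear equation [GammaA x + GammaB u = 0] in the input.  The given input
    solves it, so [GammaA x] lies in the range of [GammaB].

    The least-squares residual [E = GammaB Hx + GammaA] satisfies the normal
    equations [GammaB^T E = 0] ([frob_argmin_normal_eq]), that is, every column
    of [E] is orthogonal to the range of [GammaB].  Hence [E x] is orthogonal to
    that range; but [E x = GammaB (Hx x - u)] also belongs to it, so
    [E x = 0] ([frob_argmin_solves]): one matrix [Hx] yields a particular
    solution [Hx x] for every state for which the equation is solvable.

    Both conclusions follow.  The solution set of a solvable linear equation is
    a particular solution plus the null space of [GammaB], which the columns of
    [Hlambda] span; and [x] is annihilated by [E] and by the transition matrix,
    hence by any matrix whose rows are rescaled rows of these two. *)

Import Order.TTheory GRing.Theory Num.Theory.

Local Open Scope ring_scope.
Local Open Scope classical_set_scope.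

Section LeastSquares.

Set Implicit Arguments.
Unset Strict Implicit.
Unset Printing Implicit Defensive.

Variable R : realType.

Lemma mxtrace_gramE m n (M : 'M[R]_(m, n)) :
  \tr (M^T *m M) = \sum_i \sum_j M i j ^+ 2.
Proof.
rewrite exchange_big; apply: eq_bigr => j _; rewrite mxE.
by apply: eq_bigr => i _; rewrite mxE expr2.
Qed.

Lemma mxtrace_gram_ge0 m n (M : 'M[R]_(m, n)) : 0 <= \tr (M^T *m M).
Proof.
by rewrite mxtrace_gramE; do 2![apply: sumr_ge0 => ? _]; apply: sqr_ge0.
Qed.

Lemma mxtrace_gram_eq0 m n (M : 'M[R]_(m, n)) : \tr (M^T *m M) = 0 -> M = 0.
Proof.
have row_ge0 i : 0 <= \sum_j M i j ^+ 2 by apply: sumr_ge0 => j _; apply: sqr_ge0.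
rewrite mxtrace_gramE => /psumr_eq0P M0; apply/matrixP => i j; rewrite mxE.
have /psumr_eq0P Mi0 := M0 (fun i _ => row_ge0 i) i isT.
by apply/eqP; rewrite -sqrf_eq0; apply/eqP/Mi0 => // ? _; apply: sqr_ge0.
Qed.

Lemma frob_le m n (M N : 'M[R]_(m, n)) :
  (frob M <= frob N) = (\tr (M^T *m M) <= \tr (N^T *m N)).
Proof.
by rewrite !mxtrace_gramE ler_sqrt // -mxtrace_gramE mxtrace_gram_ge0.
Qed.

(** The gradient of half the squared objective at [H] is
    [D = G^T (G H + F)].  Moving from [H] by [- t D] changes the squared
    objective by [- 2 t |D|^2 + t^2 |G D|^2], which would be negative for some
    small [t > 0] if [D] were non-zero. *)
Lemma frob_argmin_normal_eq q s n (G : 'M[R]_(q, s)) (F : 'M[R]_(q, n)) H :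
  is_argmin (fun M => frob (G *m M + F)) H -> G^T *m (G *m H + F) = 0.
Proof.
move=> minH; set E := G *m H + F; set D := G^T *m E.
apply: mxtrace_gram_eq0.
have a_ge0 := mxtrace_gram_ge0 D; have b_ge0 := mxtrace_gram_ge0 (G *m D).
set a := \tr _ in a_ge0 *; set b := \tr _ in b_ge0.
have ED : \tr (E^T *m (G *m D)) = a by rewrite /a {2}/D trmx_mul trmxK mulmxA.
have step t : 0 <= t ^+ 2 * b - 2 * t * a.
  have := minH (H - t *: D); rewrite frob_le.
  have -> : G *m (H - t *: D) + F = E - t *: (G *m D).
    by rewrite mulmxBr -scalemxAr addrAC.
  have -> : (E - t *: (G *m D))^T = E^T - t *: (G *m D)^T.
    by rewrite linearB linearZ.
  rewrite -/E mulmxBl !mulmxBr -!scalemxAl -!scalemxAr.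
  have trB (X Y : 'M[R]_n) : \tr (X - Y) = \tr X - \tr Y by exact: raddfB.
  rewrite !(trB, mxtraceZ) ED -/b.
  have -> : \tr ((G *m D)^T *m E) = a by rewrite -mxtrace_tr trmx_mul trmxK.
  by lra.
(* [t = a / (b + 1)] is small enough: there [t^2 b <= t a]. *)
pose c := (b + 1)^-1; have c_gt0 : 0 < c by rewrite invr_gt0; lra.
have cb : c * b = 1 - c.
  by apply/(canRL (addrK _)); rewrite -{2}[c]mulr1 -mulrDr mulVf; lra.
have := step (c * a); have -> : (c * a) ^+ 2 * b - 2 * (c * a) * a =
    - ((c + c ^+ 2) * a ^+ 2).
  rewrite (_ : _ ^+ 2 * b = c * a ^+ 2 * (c * b)); first by rewrite cb; ring.
  by ring.
rewrite oppr_ge0 pmulr_rle0; last by rewrite addr_gt0 ?exprn_gt0.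
by move=> a2_le0; apply/eqP; rewrite -sqrf_eq0 eq_le a2_le0 sqr_ge0.
Qed.

(** Writing [F x] as [- G u] puts [E x] in the range of [G], to which the normal
    equations make it orthogonal. *)
Lemma frob_argmin_solves q s n (G : 'M[R]_(q, s)) (F : 'M[R]_(q, n)) H
    (x : 'cV[R]_n) (u : 'cV[R]_s) :
  is_argmin (fun M => frob (G *m M + F)) H ->
  F *m x + G *m u = 0 -> (G *m H + F) *m x = 0.
Proof.
move=> /frob_argmin_normal_eq GE0 Fx; set E := G *m H + F in GE0 *.
have Ex : E *m x = G *m (H *m x - u).
  by rewrite mulmxBr mulmxDl -mulmxA -(addr0_eq Fx) opprK.
apply: mxtrace_gram_eq0.
by rewrite {1}Ex trmx_mul -mulmxA (mulmxA G^T) GE0 mul0mx mulmx0 mxtrace0.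
Qed.

End LeastSquares.

Section NullSpaces.

Set Implicit Arguments.
Unset Strict Implicit.
Unset Printing Implicit Defensive.

Variable R : realType.

Lemma is_basis_mxP n k (H : 'M[R]_(n, k)) (S : {vspace 'cV[R]_n}) :
  is_basis_mx H S -> forall v, v \in S <-> exists l : 'cV_k, v = H *m l.
Proof.
have mulE (l : 'cV_k) : H *m l = \sum_j l j 0 *: col j H.
  apply/colP => i; rewrite mxE summxE; apply: eq_bigr => j _.
  by rewrite !mxE mulrC.
move=> /span_basis <- v; rewrite span_def big_map big_enum /=; split.
  move=> /memv_sumP[w wH ->].
  have /fin_all_exists[l wE] j : exists c, w j = c *: col j H.
    exact/vlineP/wH.
  exists (\col_j l j).
  by rewrite mulE; apply: eq_bigr => j _; rewrite wE mxE.
move=> [l ->]; rewrite mulE; apply/memv_sumP.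
exists (fun j => l j 0 *: col j H) => // j _.
by apply/vlineP; exists (l j 0).
Qed.

Lemma mxnull_normalize_rows m n (M : 'M[R]_(m, n)) (v : 'cV[R]_n) :
  M *m v = 0 -> v \in mxnull (normalize_rows M).
Proof.
move=> Mv0; apply/mxnullP/row_matrixP => i.
by rewrite row_mul rowK -scalemxAl -row_mul Mv0 !row0 scaler0.
Qed.

End NullSpaces.

Theorem theorem2 (R : realType) (n m p q : nat)
    (A : 'M[R]_n) (B : 'M[R]_(n, m)) (C : 'M[R]_(p, n))
    (x : nat -> 'cV[R]_(state_dim n m p))
    (u : nat -> 'cV[R]_(input_dim m p))
    (tau : nat) (Psi_next : 'M[R]_(q, state_dim n m p)) :
  (1 <= tau)%N ->
  x tau.+1 = Atilde m A C *m x tau + Btilde B C *m u tau ->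
  Aeqtilde A B C *m x tau = 0 ->
  x tau.+1 \in mxnull Psi_next ->
  let GammaA := Psi_next *m Atilde m A C in
  let GammaB := Psi_next *m Btilde B C in
  forall (Hx : 'M[R]_(input_dim m p, state_dim n m p))
         (k : nat) (Hlambda : 'M[R]_(input_dim m p, k)),
  is_argmin (fun M : 'M[R]_(input_dim m p, state_dim n m p) =>
               frob (GammaB *m M + GammaA)) Hx ->
  is_basis_mx Hlambda (mxnull GammaB) ->
  admissible_inputs A B C Psi_next (x tau) =
    [set uh | exists lambda : 'cV[R]_k,
                uh = Hx *m x tau + Hlambda *m lambda]
  /\ x tau \in mxnull (normalize_rows
       (col_mx (GammaB *m Hx + GammaA) (Aeqtilde A B C))).
Proof.
move=> _ dyn eq0 /mxnullP; rewrite dyn mulmxDr !mulmxA => Psi0.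
move=> GammaA GammaB Hx k Hlambda minHx basisH.
have Ex0 := frob_argmin_solves minHx Psi0; split; last first.
  by apply: mxnull_normalize_rows; rewrite mul_col_mx Ex0 eq0 col_mx0.
(* [Hx x] is a particular solution; substituting it for [GammaA x] below
   makes the equation for the input homogeneous. *)
have GammaAx : GammaA *m x tau = - (GammaB *m (Hx *m x tau)).
  by apply/esym/addr0_eq; rewrite mulmxA -mulmxDl.
apply/seteqP; split=> uh /=.
  move=> /mxnullP; rewrite mulmxDr !mulmxA -/GammaA -/GammaB GammaAx addrC.
  rewrite -mulmxBr => /mxnullP /(is_basis_mxP basisH)[l e].
  by exists l; rewrite -e addrC subrK.
move=> [l ->]; apply/mxnullP; rewrite mulmxDr !mulmxA -/GammaA -/GammaB GammaAx.
rewrite mulmxDr addKr; apply/mxnullP/(is_basis_mxP basisH).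
by exists l.
Qed.
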